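(* For all $k\ge1$ and $n\ge2$, the map $\psi$ restricts to a bijection between the set of $k$-terminal chord diagrams of size $n$ and the set of $(k-1)$-terminal chord diagrams of size $n-1$.
   Context: A chord diagram of size $n$ is a perfect matching of $\{1,\dots,2n\}$; chords are ordered pairs $(a,b)$ with $a<b$, $a$ the source and $b$ the sink. For chords $c_1=(a_1,b_1)$, $c_2=(a_2,b_2)$ with $a_1<a_2$, they cross if $a_2<b_1<b_2$, and then $c_2$ is a right neighbor of $c_1$. A chord is $j$-terminal if it has at most $j-1$ right neighbors; terminal means 1-terminal. A diagram is $k$-terminal if, for all $1\le j\le k$, there is no $j$-terminal chord before the $j$th-to-last chord in the order of sources (so every diagram is $0$-terminal, and every $k$-terminal diagram with $k\ge1$ is 1-terminal). The map $\psi$ from 1-terminal diagrams of size $n$ to diagrams of size $n-1$ ($n\ge 2$): let $T$ be 1-terminal with chords $c_1<\dots<c_n$ ordered by source. The source-sink group of a chord $c$ consists of the source of $c$ together with the maximal run of consecutive sinks immediately following it (excluding the sink of $c$ itself). Then $\psi(T)$ is obtained from $T$ by (1) moving each source to the end of its source-sink group (all other endpoints keeping their relative order and every source staying paired with its sink), and (2) deleting the terminal chord $c_n$; endpoints are then relabelled order-preservingly. *)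

(* Defs.v *)
From mathcomp Require Import all_boot.

Set Implicit Arguments.
Unset Strict Implicit.
Unset Printing Implicit Defensive.

(* The points 1, ..., 2n are represented by the ordinals 0, ..., 2n - 1. *)
Notation point n := (ordinal (2 * n)).

Notation chord n := (point n * point n)%type.

Section ChordDiagram.

Variable n : nat.
Implicit Types (D : {set chord n}) (c d : chord n) (x y z : point n).

Definition source c : point n := c.1.
Definition sink c : point n := c.2.

(* A perfect matching, given by its set of chords (a, b) with a < b. *)
Definition chord_diagram D : bool :=
  [forall c in D, (source c < sink c)%N] &&
  [forall x, #|[set c in D | (source c == x) || (sink c == x)]| == 1].

Definition right_neighbor c1 c2 : bool :=
  [&& source c1 < source c2, source c2 < sink c1 & sink c1 < sink c2]%N.

Definition terminal_chord D (j : nat) c : bool :=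
  #|[set d in D | right_neighbor c d]| <= j.-1.

(* Chords are ordered by their sources: d is the j-th to last chord of D when
   exactly j chords, d included, have their source at or after that of d. *)
Definition jth_to_last D (j : nat) d : bool :=
  (d \in D) && (#|[set e in D | (source d <= source e)%N]| == j).

(* For j larger than the size there is no j-th to last chord, and no
   condition. *)
Definition terminal_diagram (k : nat) D : bool :=
  [forall j : 'I_k.+1, (1 <= j)%N ==>
    [forall c in D, forall d in D,
      jth_to_last D j d && (source c < source d)%N ==>
      ~~ terminal_chord D j c]].

Definition is_sink D x : bool := [exists c in D, sink c == x].

Definition sink_run D c : {set point n} :=
  [set y : point n | (source c < y)%N &
    [forall z : point n, (source c < z <= y)%N ==> is_sink D z]].

Definition source_sink_group D c : {set point n} :=
  source c |: (sink_run D c :\ sink c).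

(* Order of the endpoints after each source has moved to the end of its
   source-sink group: coordinates are doubled, a sink at y stays at 2y, and
   the source of c is placed at 2m + 1, just after the last element m of the
   group of c. *)
Definition moved_position D x : nat :=
  if [pick c in D | source c == x] is Some c
  then (\max_(y in source_sink_group D c) (y : nat)).*2.+1
  else (x : nat).*2.

Definition delete_last D : {set chord n} :=
  [set c in D | ~~ jth_to_last D 1 c].

Definition is_endpoint D x : bool :=
  [exists c in D, (source c == x) || (sink c == x)].

(* The order-preserving label of x: its rank, for the order given by
   moved_position, among the endpoints that are not deleted. *)
Definition new_label D x : nat :=
  #|[set y : point n | is_endpoint (delete_last D) y &
             (moved_position D y < moved_position D x)%N]|.

(* Only meaningful when D is a 1-terminal chord diagram and 2 <= n. *)
Definition psi D : {set chord n.-1} :=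
  [set d : chord n.-1 | [exists c in delete_last D,
     (nat_of_ord d.1 == new_label D (source c)) &&
     (nat_of_ord d.2 == new_label D (sink c))]].

End ChordDiagram.

Definition terminal_diagrams (k n : nat) : {set {set chord n}} :=
  [set D : {set chord n} | chord_diagram D && terminal_diagram k D].

(* Main.v *)
(* List the chords of a diagram by increasing source as (s_0, t_0), ...,
   (s_{n-1}, t_{n-1}).  If T is 1-terminal, then s_0 = 0, t_{n-1} = 2n - 1 and
   s_{i+1} < t_i for i < n - 1.  Moving s_i to the end of its source-sink group
   puts it just before s_{i+1}, so in these coordinates psi is the shift

     s'_i = s_{i+1} - 1,   t'_i = t_i - 1   (i < n - 1),

   whose inverse appends s_0 = 0 and t_{n-1} = 2n - 1.  Each chord but the last
   loses exactly one right neighbor, namely the chord with the last source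
   before t_i; hence j-terminality for T is (j - 1)-terminality for psi T. *)

Require Import Defs.
From mathcomp Require Import all_boot.
From mathcomp Require Import zify.

Set Implicit Arguments.
Unset Strict Implicit.
Unset Printing Implicit Defensive.

(** * Codes of diagrams and sums over their endpoints *)

(* s i is the i-th source in increasing order and t i is the sink of its chord;
   only the indices i < n are meaningful. *)
Record is_code (n : nat) (s t : nat -> nat) : Prop := IsCode {
  code_incr : forall i j, i < j -> j < n -> s i < s j;
  code_lt : forall i, i < n -> s i < t i;
  code_bound : forall i, i < n -> t i < 2 * n;
  code_inj : forall i j, i < n -> j < n -> t i = t j -> i = j;
  code_neq : forall i j, i < n -> j < n -> s i <> t j }.

Definition decode (n : nat) (s t : nat -> nat) : {set chord n} :=
  [set c : chord n |
    [exists i : 'I_n, (source c == s i :> nat) && (sink c == t i :> nat)]].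

Definition nb_right (n : nat) (s t : nat -> nat) (i : nat) : nat :=
  \sum_(j < n) [&& s i < s j, s j < t i & t i < t j].

Lemma code_incrE n s t i j : is_code n s t -> i < n -> j < n ->
  (s i < s j) = (i < j).
Proof.
move=> C ltin ltjn; case: (ltngtP i j) => [ltij|ltji|->]; last exact: ltnn.
  by rewrite (code_incr C ltij ltjn).
by apply/negbTE; rewrite -leqNgt ltnW // (code_incr C ltji ltin).
Qed.

Lemma code_source_inj n s t i j : is_code n s t -> i < n -> j < n ->
  s i = s j -> i = j.
Proof.
move=> C hi hj e; have := code_incrE C hi hj; have := code_incrE C hj hi.
by rewrite e ltnn; lia.
Qed.

(** The last clause turns cardinalities over a diagram into sums over indices, where codes can be
    compared by arithmetic. *)
Definition enumerates_chords (n : nat) (s t : nat -> nat)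
    (ch : 'I_n -> chord n) : Prop :=
  [/\ forall i, source (ch i) = s i :> nat /\ sink (ch i) = t i :> nat,
      forall c, c \in decode n s t <-> exists i, c = ch i &
      forall F : chord n -> nat,
        \sum_(c in decode n s t) F c = \sum_(i < n) F (ch i)].

Lemma decode_chords n s t : is_code n s t ->
  exists ch : 'I_n -> chord n, enumerates_chords s t ch.
Proof.
move=> C.
have ltt (i : 'I_n) : t i < 2 * n by exact: code_bound C _ (ltn_ord i).
have lts (i : 'I_n) : s i < 2 * n.
  exact: ltn_trans (code_lt C (ltn_ord i)) (ltt i).
pose ch i : chord n := (Ordinal (lts i), Ordinal (ltt i)).
have chP c : reflect (exists i, c = ch i) (c \in decode n s t).
  rewrite inE; apply: (iffP existsP) => -[i]; last first.
    by move=> ->; exists i; rewrite /= !eqxx.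
  move=> /andP[/eqP ha /eqP hb]; exists i; rewrite [c]surjective_pairing.
  by congr pair; apply: val_inj.
have ch_inj : injective ch.
  move=> i j [e _]; apply: val_inj.
  exact: code_source_inj C (ltn_ord i) (ltn_ord j) e.
exists ch; split=> [//|c|F]; first by split=> /chP.
rewrite (_ : decode n s t = [set ch i | i in 'I_n]).
  by rewrite big_imset //= => i j _ _ /ch_inj.
apply/setP=> c; apply/chP/imsetP => [[i ->]|[i _ ->]]; first by exists i.
by exists i.
Qed.

(** The 2n endpoints are pairwise distinct, so the map from ['I_n + 'I_n] to the 2n points is
    injective between sets of equal size, hence bijective. *)
Lemma code_sum_points n s t (a b : 'I_n -> point n) (F : point n -> nat) :
  is_code n s t ->
  (forall i, a i = s i :> nat) -> (forall i, b i = t i :> nat) ->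
  \sum_x F x = \sum_i (F (a i) + F (b i)).
Proof.
move=> C aE bE.
pose h (u : 'I_n + 'I_n) := match u with inl i => a i | inr i => b i end.
have h_inj : injective h.
  move=> [i|i] [j|j] /(congr1 val) /=; rewrite ?aE ?bE => e.
  - congr inl; apply: val_inj.
    exact: code_source_inj C (ltn_ord i) (ltn_ord j) e.
  - by case: (code_neq C (ltn_ord i) (ltn_ord j)).
  - by case: (code_neq C (ltn_ord j) (ltn_ord i)).
  - congr inr; apply: val_inj; exact: code_inj C _ _ (ltn_ord i) (ltn_ord j) e.
have h_bij : bijective h.
  by apply: inj_card_bij => //; rewrite card_sum !card_ord; lia.
rewrite (reindex h) /=; last exact: onW_bij.
by rewrite big_sumType big_split.
Qed.

(** The indicator of [x] has sum 1 over all points, so some endpoint of the code must contribute. *)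
Lemma code_cover n s t x : is_code n s t -> x < 2 * n ->
  exists2 i, i < n & x = s i \/ x = t i.
Proof.
move=> C ltx; have [ch [chE _ _]] := decode_chords C.
have /eqP := code_sum_points (fun y => y == x :> nat) C
  (fun i => (chE i).1) (fun i => (chE i).2).
rewrite (bigD1 (Ordinal ltx)) //= eqxx.
case: (boolP [exists i : 'I_n, (s i == x) || (t i == x)]).
  by move=> /existsP[i /orP[]/eqP e _]; exists i; auto.
move=> /existsPn h; rewrite [X in _ == X]big1 // => i _.
by have [-> ->] := chE i; have := h i; case: eqP => //; case: eqP.
Qed.

Lemma code_first_source n s t : is_code n s t -> 0 < n -> s 0 = 0.
Proof.
move=> C n_gt0; have lt0 : 0 < 2 * n by lia.
have [i hi [e|e]] := code_cover C lt0; last by have := code_lt C hi; lia.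
by case: i hi e => // i hi e; have := code_incr C (ltn0Sn i) hi; lia.
Qed.

Lemma sum_ltn n a : a <= n -> \sum_(x < n) (x < a : nat) = a.
Proof.
move=> lean; rewrite -[RHS]card_ord -sum1_card (big_ord_widen _ (fun=> 1) lean).
by rewrite [RHS]big_mkcond; apply: eq_bigr => i _; case: ifP.
Qed.

Lemma card_set_sum (T : finType) (A : {set T}) (P : pred T) :
  #|[set x in A | P x]| = \sum_(x in A) P x.
Proof.
rewrite -sum1_card big_mkcond [RHS]big_mkcond /=.
by apply: eq_bigr => x _; rewrite inE; case: (x \in A); case: (P x).
Qed.

(** * Chord diagrams and codes determine each other *)

Lemma decode_chord_diagram n s t :
  is_code n s t -> chord_diagram (decode n s t).
Proof.
move=> C; have [ch [chE chP chS]] := decode_chords C.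
apply/andP; split.
  apply/forall_inP => c /chP[i ->]; have [-> ->] := chE i.
  exact: code_lt C _ (ltn_ord i).
apply/forallP => x; rewrite card_set_sum chS.
(* The indicator of [x] sums to 1. As a chord's source and sink differ, the disjunction in the goal
   counts as the sum of its two sides. *)
have := code_sum_points (fun y => y == x) C
  (fun i => (chE i).1) (fun i => (chE i).2).
rewrite (bigD1 x) //= eqxx big1 => [|y /negbTE->//].
rewrite addn0 => e; apply/eqP; apply: etrans (esym e); apply: eq_bigr => i _.
rewrite -!val_eqE /=; have [-> ->] := chE i.
have := code_neq C (ltn_ord i) (ltn_ord i).
by case: eqP => [->|_]; case: eqP => // ->.
Qed.

Lemma code_rank n s t i : is_code n s t -> i < n ->
  \sum_(j < n) (s j < s i : nat) = i.
Proof.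
move=> C hi; rewrite -[RHS](sum_ltn (ltnW hi)).
by apply: eq_bigr => j _; rewrite (code_incrE C).
Qed.

(** The index of a chord is the number of chords with a smaller source, which depends only on the
    set of chords. *)
Lemma decode_inj n s t s' t' : is_code n s t -> is_code n s' t' ->
  decode n s t = decode n s' t' ->
  forall i, i < n -> s i = s' i /\ t i = t' i.
Proof.
move=> C C' eD i hi.
have [ch [chE chP chS]] := decode_chords C.
have [ch' [chE' chP' chS']] := decode_chords C'.
have /chP' [j ej] : ch (Ordinal hi) \in decode n s' t'.
  by rewrite -eD; apply/chP; exists (Ordinal hi).
have [] := chE (Ordinal hi); rewrite {}ej; have [-> ->] := chE' j => /= es et.
rewrite -es -et; suff -> : i = j by [].
rewrite -(code_rank C hi) -(code_rank C' (ltn_ord j)) es.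
have := chS' (fun c => source c < s i : nat); rewrite -eD chS => h.
apply: etrans (etrans h _); apply: eq_bigr => l _.
  by have [-> _] := chE l.
by have [-> _] := chE' l.
Qed.

Lemma eq_decode n s t s' t' :
  (forall i, i < n -> s i = s' i /\ t i = t' i) ->
  decode n s t = decode n s' t'.
Proof.
move=> h; apply/setP => c; rewrite !inE; apply: eq_existsb => i.
by have [-> ->] := h i (ltn_ord i).
Qed.

(** The code is read off the list of chords sorted by source. *)
Lemma chord_diagram_code n (D : {set chord n}) : chord_diagram D ->
  exists s t, is_code n s t /\ D = decode n s t.
Proof.
move=> /andP[/forall_inP ltD /forallP D1].
have uniqD c d x : c \in D -> d \in D ->
    (source c == x) || (sink c == x) -> (source d == x) || (sink d == x) ->
    c = d.
  move=> cD dD cx dx; have /cards1P[e eE] := D1 x.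
  have : c \in [set e]; first by rewrite -eE inE cD.
  have : d \in [set e]; first by rewrite -eE inE dD.
  by rewrite !inE => /eqP-> /eqP->.
(* Double count the incidences of chords with points: two for each chord, one for each of the 2n
   points. *)
have cardD : #|D| = n.
  apply/eqP; rewrite -(eqn_pmul2l (isT : 0 < 2)); apply/eqP.
  rewrite -[RHS]card_ord -[RHS]sum1_card (mulnC 2 #|D|) -sum_nat_const.
  transitivity (\sum_(c in D) \sum_(x < 2 * n)
                 ((source c == x) || (sink c == x) : nat)).
    apply: eq_bigr => c cD; rewrite (bigD1 (source c)) //= eqxx.
    have neq : sink c != source c.
      by rewrite -val_eqE /= gtn_eqF // ltD.
    rewrite (bigD1 (sink c)) //= eqxx orbT big1 // => x /andP[].
    by rewrite !(eq_sym x) => /negbTE-> /negbTE->.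
  rewrite exchange_big /=; apply: eq_bigr => x _.
  by rewrite -card_set_sum; apply/eqP/D1.
pose le (c d : chord n) := source c <= source d.
pose cs := sort le (enum D).
have size_cs : size cs = n by rewrite size_sort -cardE.
have le_tr : transitive le by move=> b a c; exact: leq_trans.
have cs_sorted : sorted le cs by apply: sort_sorted => a b; exact: leq_total.
have mem_cs c : (c \in cs) = (c \in D) by rewrite mem_sort mem_enum.
have cs_uniq : uniq cs by rewrite sort_uniq enum_uniq.
(* For n = 0 no point is available as a default for [nth], but then any code will do. *)
case: (posnP n) => [n0|n_gt0].
  exists id, id; split; first by split=> //; lia.
  by apply/setP=> c; have := ltn_ord c.1; lia.
have lt0 : 0 < 2 * n by lia.
pose p0 : point n := Ordinal lt0.
pose nt i := nth (p0, p0) cs i.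
have ntD i : i < n -> nt i \in D by move=> hi; rewrite -mem_cs mem_nth ?size_cs.
have nt_inj i j : i < n -> j < n -> nt i = nt j -> i = j.
  by move=> hi hj /eqP; rewrite nth_uniq ?size_cs // => /eqP.
exists (fun i => source (nt i) : nat), (fun i => sink (nt i) : nat).
split; last first.
  apply/setP=> c; rewrite inE.
  apply/idP/existsP => [cD|[i /andP[/eqP h1 /eqP h2]]].
    have ltc : index c cs < n by rewrite -[X in _ < X]size_cs index_mem mem_cs.
    exists (Ordinal ltc); rewrite /nt /= nth_index ?mem_cs //.
    by rewrite /source /sink !eqxx.
  rewrite (_ : c = nt i) ?ntD //.
  rewrite [LHS]surjective_pairing [RHS]surjective_pairing.
  by congr pair; apply: val_inj.
split.
(* Sorting gives only the weak inequality; equal sources would make the two chords coincide. *)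
- move=> i j ltij hj; rewrite ltn_neqAle; apply/andP; split.
    apply/eqP => /val_inj e.
    have : nt i = nt j by apply: (uniqD _ _ (source (nt i))) => //;
       rewrite ?ntD ?e ?eqxx //; lia.
    by move=> /nt_inj; lia.
  by apply: (sorted_leq_nth le_tr) => //; rewrite ?inE ?size_cs /le //; lia.
- by move=> i hi; apply/ltD/ntD.
- by move=> i _; apply: ltn_ord.
- move=> i j hi hj /val_inj e; apply: nt_inj => //.
  by apply: (uniqD _ _ (sink (nt i))); rewrite ?ntD ?e ?eqxx ?orbT.
- move=> i j hi hj /val_inj e.
  have eij : nt i = nt j.
    by apply: (uniqD _ _ (source (nt i))); rewrite ?ntD ?e ?eqxx ?orbT.
  by have := ltD _ (ntD _ hi); rewrite e eij ltnn.
Qed.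

(** * Terminality in terms of codes *)

Lemma jth_to_last_decode n s t (ch : 'I_n -> chord n) j (d : 'I_n) :
  is_code n s t -> enumerates_chords s t ch ->
  jth_to_last (decode n s t) j (ch d) = (d + j == n).
Proof.
move=> C [chE chP chS]; rewrite /jth_to_last.
have -> : ch d \in decode n s t by apply/chP; exists d.
rewrite card_set_sum chS /=.
(* Exactly [d] sources precede that of [ch d], so n - d of them lie at or after it. *)
have := code_rank C (ltn_ord d).
have : \sum_(e < n) ((s e < s d : nat) + (s d <= s e : nat)) = n.
  rewrite -[RHS]card_ord -[RHS]sum1_card; apply: eq_big => [//|e _].
  by case: ltnP.
rewrite big_split /= => + e1; rewrite {}e1 => e2.
have -> : \sum_(i < n) (source (ch d) <= source (ch i) : nat) =
          \sum_(i < n) (s d <= s i : nat).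
  by apply: eq_bigr => i _; have [-> _] := chE i; have [-> _] := chE d.
by move: e2; set a := \sum_(i < n) _; lia.
Qed.

(** The j-th to last chord has index n - j, so the chords before it are those with i + j < n. *)
Lemma terminal_decode k n s t : is_code n s t ->
  terminal_diagram k (decode n s t) <->
  (forall j i, 0 < j <= k -> i + j < n -> j <= nb_right n s t i).
Proof.
move=> C; have [ch E] := decode_chords C; have [chE chP chS] := E.
have jthE j d := jth_to_last_decode j d C E.
have termE j i : 0 < j ->
    terminal_chord (decode n s t) j (ch i) = (nb_right n s t i < j).
  move=> j_gt0; rewrite /terminal_chord card_set_sum chS.
  rewrite (_ : \sum_(i < n) _ = nb_right n s t i); first by lia.
  apply: eq_bigr => l _; rewrite /right_neighbor.
  by have [-> ->] := chE l; have [-> ->] := chE i.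
split=> [/forallP h j i /andP[j_gt0 lejk] ltijn|h].
  have ltjk : j < k.+1 by [].
  have lti : i < n by lia.
  have ltd : n - j < n by lia.
  have := h (Ordinal ltjk); rewrite j_gt0 /=.
  have inD l : ch l \in decode n s t by apply/chP; exists l.
  move=> /forall_inP/(_ _ (inD (Ordinal lti))).
  move=> /forall_inP/(_ _ (inD (Ordinal ltd))).
  rewrite jthE termE //= -leqNgt.
  have [-> _] := chE (Ordinal lti); have [-> _] := chE (Ordinal ltd).
  move=> /implyP; apply; rewrite /= (code_incrE C) //; lia.
apply/forallP => -[j /= ltjk]; apply/implyP => j_gt0.
apply/forall_inP => _ /chP[i ->]; apply/forall_inP => _ /chP[d ->].
rewrite jthE termE // -leqNgt; apply/implyP => /andP[/eqP e].
have [-> _] := chE i; have [-> _] := chE d; rewrite (code_incrE C) // => ltid.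
by apply: h; lia.
Qed.

(* These codes are exactly those of the 1-terminal diagrams. *)
Definition no_early_terminal (m : nat) (s t : nat -> nat) : Prop :=
  t m = (2 * m).+1 /\ forall i, i < m -> s i.+1 < t i.

(** The case j = 1 gives every chord but the last a right neighbor. The sink of that neighbor lies
    beyond [t i], so only the last chord can own the point 2m + 1; its source lies below [t i] and
    is at least [s i.+1]. *)
Lemma terminal_no_early_terminal k m s t : is_code m.+1 s t ->
  terminal_diagram k.+1 (decode m.+1 s t) -> no_early_terminal m s t.
Proof.
move=> C /(terminal_decode _ C) h.
have nbr i : i < m ->
    exists j, [/\ j < m.+1, s i < s j, s j < t i & t i < t j].
  move=> lti; have := h 1 i isT; rewrite addn1 => /(_ lti).
  rewrite lt0n sum_nat_eq0 => /forallPn[j] /=.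
  by rewrite eqb0 negbK => /and3P[*]; exists j; split.
split=> [|i lti].
  have [|i hi [e|e]] := @code_cover _ _ _ (2 * m).+1 C; first by lia.
    by have := code_lt C hi; have := code_bound C hi; lia.
  have [ltim|] := ltnP i m; last by move=> lemi; rewrite e; congr t; lia.
  have [j [hj _ _]] := nbr i ltim; have := code_bound C hj; lia.
have [j [hj + ltji _]] := nbr i lti.
rewrite (code_incrE C) //; last by lia.
move=> ltij; apply: leq_ltn_trans ltji.
by rewrite leqNgt (code_incrE C) //; lia.
Qed.

(* If s_q is the last source before t_i, then c_q is the right neighbor of c_i
   that the shift loses. *)
Lemma nb_right_shift m s t i : is_code m.+1 s t -> no_early_terminal m s t ->
  i < m ->
  nb_right m.+1 s t i =
  (nb_right m (fun i => (s i.+1).-1) (fun i => (t i).-1) i).+1.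
Proof.
move=> C [tm hst] lti; set G := nb_right m _ _ _.
have exq : exists q, (q <= m) && (s q < t i).
  by exists i.+1; rewrite hst // lti.
have [|q /andP[leqm ltq] qmax] := ex_maxnP exq (m := m).
  by move=> j /andP[].
have ltm1 : i < m.+1 by lia.
have lei1q : i.+1 <= q by apply: qmax; rewrite lti hst.
have s_pos j : 0 < j -> j < m.+1 -> 0 < s j.
  by move=> j0 hj; have := code_incr C j0 hj; lia.
have t_pos j : j < m.+1 -> 0 < t j by move=> hj; have := code_lt C hj; lia.
pose P j := [&& (s i.+1).-1 < (s j.+1).-1, (s j.+1).-1 < (t i).-1 &
                (t i).-1 < (t j).-1].
(* Both counts become sums over the same indices, the lost neighbor being the summand [j == q]; they
   are then compared term by term. *)
have -> : G.+1 = \sum_(j < m.+1) (((j < m) && P j : nat) + (j == q :> nat)).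
  rewrite big_split /= big_ord_recr /= ltnn addn0.
  have ltq1 : q < m.+1 by [].
  rewrite [X in _ + X](bigD1 (Ordinal ltq1)) //= eqxx [X in _ = _ + (_ + X)]big1
    => [|j /negbTE].
  2: by rewrite -val_eqE => ->.
  rewrite addn0 addn1; congr _.+1; apply: eq_bigr => j _.
  by rewrite ltn_ord.
apply: eq_bigr => j _; have hj := ltn_ord j.
have sij := code_incrE C ltm1 hj.
have sqj : (s q < s j) = (q < j) by apply: (code_incrE C).
have sjq : (s j < s q) = (j < q) by apply: (code_incrE C).
have nji := code_neq C hj ltm1.
have ti0 := t_pos _ ltm1; have tj0 := t_pos _ hj.
have si0 := s_pos i.+1 isT lti.
have above l : q < l -> l <= m -> t i <= s l.
  move=> ltql lelm; rewrite leqNgt; apply/negP => h.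
  by have := qmax l; rewrite lelm h; lia.
(* For j < q both [s j] and [s j.+1] lie below [t i]; for j > q neither does; at j = q only [s j]
   does, so the shifted term vanishes. *)
rewrite /P; case: (ltngtP j q) => [ltjq|ltqj|ejq].
- have ltjm : j < m by lia.
  have sj0 := s_pos j.+1 isT ltjm.
  have : (s i.+1 < s j.+1) = (i < j) by rewrite (code_incrE C).
  have : s j.+1 <= s q by rewrite leqNgt (code_incrE C) //; lia.
  lia.
- have := above j ltqj hj; case: (ltnP j m) => //= ltjm; last by lia.
  have := code_incr C (ltnSn j) ltjm; lia.
(* If q < m, then [t i <= s q.+1 < t q]; if q = m, then [t m] is the last point. *)
- have : t i < t j.
    have [ltjm|lemj] := ltnP j m.
      have := above j.+1; have := hst j ltjm; lia.
    have -> : nat_of_ord j = m by lia.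
    have := code_bound C ltm1; have := code_inj C ltm1 (ltnSn m).
    by rewrite tm; lia.
  case: (ltnP j m) => /= ltjm; last by lia.
  have := above j.+1; have := s_pos j.+1; lia.
Qed.

(** * Computation of [psi] on a code *)

Section PsiDecode.

Variables (m : nat) (s t : nat -> nat) (ch : 'I_m.+1 -> chord m.+1).
Hypothesis C : is_code m.+1 s t.
Hypothesis NT : no_early_terminal m s t.
Hypothesis E : enumerates_chords s t ch.
Let T := decode m.+1 s t.

Let chE i : source (ch i) = s i :> nat /\ sink (ch i) = t i :> nat.
Proof. by have [] := E. Qed.

Let chP c : c \in T <-> exists i, c = ch i.
Proof. by have [] := E. Qed.

Lemma mem_delete_last c :
  c \in delete_last T <-> exists2 i : 'I_m.+1, i < m & c = ch i.
Proof.
have jthE i := jth_to_last_decode 1 i C E.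
rewrite inE; split=> [/andP[/chP[i ->]]|[i ltim ->]].
  by rewrite jthE => h; exists i => //; have := ltn_ord i; lia.
by rewrite jthE; apply/andP; split; [apply/chP; exists i | lia].
Qed.

Lemma is_endpoint_delete_last_source i :
  is_endpoint (delete_last T) (source (ch i)) = (i < m).
Proof.
apply/exists_inP/idP => [[c /mem_delete_last[j ltjm ->]]|ltim]; last first.
  by exists (ch i); [apply/mem_delete_last; exists i | rewrite eqxx].
rewrite -!val_eqE /=; have [-> ->] := chE j; have [-> _] := chE i.
case/orP => /eqP e; last by case: (code_neq C (ltn_ord i) (ltn_ord j)).
by rewrite -(code_source_inj C (ltn_ord j) (ltn_ord i) e).
Qed.

Lemma is_endpoint_delete_last_sink i :
  is_endpoint (delete_last T) (sink (ch i)) = (i < m).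
Proof.
apply/exists_inP/idP => [[c /mem_delete_last[j ltjm ->]]|ltim]; last first.
  by exists (ch i); [apply/mem_delete_last; exists i | rewrite eqxx orbT].
rewrite -!val_eqE /=; have [-> ->] := chE j; have [_ ->] := chE i.
case/orP => /eqP e; first by case: (code_neq C (ltn_ord j) (ltn_ord i)).
by rewrite -(code_inj C (ltn_ord j) (ltn_ord i) e).
Qed.

Lemma moved_position_sink i : moved_position T (sink (ch i)) = (t i).*2.
Proof.
rewrite /moved_position; case: pickP => [c|_].
  move=> /andP[/chP[j ->] /eqP/(congr1 val)].
  have [/= -> _] := chE j; have [_ ->] := chE i => e.
  by case: (code_neq C (ltn_ord j) (ltn_ord i)).
by have [_ ->] := chE i.
Qed.

Lemma is_sink_decode (z : point m.+1) :
  is_sink T z <-> exists i : 'I_m.+1, z = t i :> nat.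
Proof.
split=> [/exists_inP[_ /chP[i ->] /eqP<-]|[i e]].
  by exists i; have [_ ->] := chE i.
apply/exists_inP; exists (ch i); first by apply/chP; exists i.
by apply/eqP/val_inj; have [_ /= ->] := chE i.
Qed.

(* The group of c_i ends just before the next source. *)
Lemma moved_position_source (i : 'I_m.+1) : i < m ->
  moved_position T (source (ch i)) = (s i.+1).-1.*2.+1.
Proof.
move=> ltim; have [_ hst] := NT.
have ltim1 : i.+1 < m.+1 := ltim.
have ltsi1 : s i < s i.+1 := code_incr C (ltnSn i) ltim.
have ltsi2 : s i.+1 < 2 * m.+1.
  by apply: ltn_trans (hst i ltim) _; apply: code_bound C _ _.
rewrite /moved_position; case: pickP => [c|/(_ (ch i))]; last first.
  by rewrite eqxx andbT => /negP[]; apply/chP; exists i.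
move=> /andP[/chP[j ->] /eqP/(congr1 val)] /=.
have [-> _] := chE j; have [-> _] := chE i => /(code_source_inj C) e.
have {j e} -> : j = i by apply/val_inj/e; apply: ltn_ord.
(* Upper bound: a run reaching [s i.+1] would make this source a sink. Lower bound: the point just
   before [s i.+1] belongs to the group. *)
congr _.*2.+1; apply/eqP; rewrite eqn_leq; apply/andP; split.
  apply/bigmax_leqP => y; rewrite !inE => /orP[/eqP->|].
    by have [-> _] := chE i; lia.
  case/and3P=> _ _ /forallP/(_ (Ordinal ltsi2)) /=.
  have [-> _] := chE i; rewrite ltsi1 /=.
  case: (ltnP y (s i.+1)) => [|_]; first by lia.
  move=> /is_sink_decode[j /= e].
  by case: (code_neq C ltim1 (ltn_ord j)).
have ltsi : (s i.+1).-1 < 2 * m.+1 by lia.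
(* This point is [s i] itself or ends a run of sinks, as no source lies strictly between [s i] and
   [s i.+1]. It is not the excluded sink, because [s i.+1 < t i]. *)
have ySi (y := Ordinal ltsi) : y \in source_sink_group T (ch i).
  rewrite !inE -!val_eqE /=; have [-> ->] := chE i.
  case: eqP => //= neqs; apply/and3P; split.
  - by have := hst i ltim; apply/contraTneq; lia.
  - lia.
  apply/forallP => z; apply/implyP => /andP[ltsz ltzs].
  have [l hl [e|e]] := code_cover C (ltn_ord z).
    have := code_incrE C (ltn_ord i) hl; have := code_incrE C hl ltim1.
    by rewrite -e; lia.
  by apply/is_sink_decode; exists (Ordinal hl).
by rewrite (leq_bigmax_cond (Ordinal ltsi)).
Qed.

(** Here [X] stands for [s i.+1] when [x] is the source of chord i, and for [t i] when it is the
    sink. The surviving endpoints moved before [x] correspond to the points below [X] other than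
    [s 0] and [t m]. There are X points below [X]; among them is [s 0 = 0] but not [t m = 2m + 1],
    which leaves X - 1. *)
Lemma new_labelE (x : point m.+1) (X : nat) : 0 < X <= (2 * m).+1 ->
  moved_position T x = (X.-1).*2.+1 \/
  moved_position T x = X.*2 /\ (forall j, j < m.+1 -> s j <> X) ->
  new_label T x = X.-1.
Proof.
move=> /andP[X_gt0 leX] hX; have [tm hst] := NT.
have leX2 : X <= 2 * m.+1 by lia.
have sums := code_sum_points _ C (fun i => (chE i).1) (fun i => (chE i).2).
transitivity (\sum_(i < m) ((s i.+1 < X : nat) + (t i < X : nat))); last first.
  have := sum_ltn leX2; rewrite sums.
  rewrite big_split /= big_ord_recl big_ord_recr /=.
  have [-> _] := chE ord0; have [_ ->] := chE ord_max.
  rewrite (code_first_source C) // X_gt0 /= tm ltnNge leX /= addn0.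
  rewrite big_split /= => e.
  rewrite -[Y in _ = Y.-1]e -addnA add1n /=; congr (_ + _).
    by apply: eq_bigr => i _; have [-> _] := chE (lift ord0 i).
  by apply: eq_bigr => i _; have [_ ->] := chE (widen_ord (leqnSn m) i).
rewrite /new_label -sum1_card big_mkcond /= sums big_ord_recr /= !inE.
rewrite is_endpoint_delete_last_source is_endpoint_delete_last_sink /= ltnn /=.
rewrite !addn0; apply: eq_bigr => i _; rewrite !inE.
rewrite is_endpoint_delete_last_source is_endpoint_delete_last_sink /=.
have ltim := ltn_ord i; have lti1 : i < m.+1 by lia.
rewrite ltim moved_position_source // moved_position_sink /=.
have incr := code_incr C (ltnSn i) ltim.
(* A moved source sits at 2 [s i.+1] - 1, so comparing it with a sink at 2X only tests
   [s i.+1 <= X]; this is strict because [X] is not a source. *)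
by case: hX => [->|[-> /(_ i.+1 ltim)]]; do 2 case: ifP; lia.
Qed.

Lemma psi_enumerated :
  psi T = decode m (fun i => (s i.+1).-1) (fun i => (t i).-1).
Proof.
have [tm hst] := NT.
have labels (i : 'I_m.+1) : i < m ->
    new_label T (source (ch i)) = (s i.+1).-1 /\
    new_label T (sink (ch i)) = (t i).-1.
  move=> ltim; have lti1 : i < m.+1 by lia.
  have hs := code_incr C (ltnSn i) ltim; have hts := hst i ltim.
  have htb := code_bound C lti1.
  split; apply: new_labelE; rewrite ?moved_position_source //; try lia.
  right; split; first exact: moved_position_sink.
  by move=> j hj; apply: (code_neq C hj lti1).
apply/setP => d; rewrite !inE.
apply/exists_inP/existsP => [[c /mem_delete_last[i ltim ->]]|[i]].
  by have [-> ->] := labels i ltim; exists (Ordinal ltim).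
have lti1 : i < m.+1 by have := ltn_ord i; lia.
have [e1 e2] := labels (Ordinal lti1) (ltn_ord i).
move=> h; exists (ch (Ordinal lti1)); last by rewrite e1 e2; exact: h.
by apply/mem_delete_last; exists (Ordinal lti1); first exact: ltn_ord i.
Qed.

End PsiDecode.

Lemma psi_decode m s t : is_code m.+1 s t -> no_early_terminal m s t ->
  psi (decode m.+1 s t) = decode m (fun i => (s i.+1).-1) (fun i => (t i).-1).
Proof.
move=> C NT; have [ch E] := decode_chords C.
exact: psi_enumerated C NT E.
Qed.

(** * The shift of codes and its inverse *)

(** The inequality [s i.+1 < t i] becomes source before sink after the shift, and [t m] occupying
    the last point keeps the other sinks within the smaller bound. *)
Lemma is_code_shift m s t : is_code m.+1 s t -> no_early_terminal m s t ->
  is_code m (fun i => (s i.+1).-1) (fun i => (t i).-1).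
Proof.
move=> C [tm hst].
have s_pos i : i < m -> 0 < s i.+1.
  by move=> hi; have := code_incr C (ltn0Sn i) hi; lia.
have lt1 i : i < m -> i < m.+1 by lia.
split=> [i j ltij hj|i hi|i hi|i j hi hj|i j hi hj].
- by have := s_pos i; have := @code_incr _ _ _ C i.+1 j.+1 ltij hj; lia.
- by have := s_pos i hi; have := hst i hi; lia.
- have := code_bound C (lt1 i hi).
  have /eqP : t i <> t m by move/(code_inj C (lt1 i hi) (ltnSn m)); lia.
  by rewrite tm; lia.
- have := hst i hi; have := hst j hj => h1 h2 e.
  by apply: (code_inj C (lt1 i hi) (lt1 j hj)); lia.
- have := @code_neq _ _ _ C i.+1 j hi (lt1 j hj).
  by have := s_pos i hi; have := hst j hj; lia.
Qed.

Lemma terminal_shift k m s t : is_code m.+1 s t -> no_early_terminal m s t ->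
  terminal_diagram k.+1 (decode m.+1 s t) <->
  terminal_diagram k
    (decode m (fun i => (s i.+1).-1) (fun i => (t i).-1)).
Proof.
move=> C NT; have C' := is_code_shift C NT.
have [to1 of1] := terminal_decode k.+1 C.
have [to2 of2] := terminal_decode k C'.
split=> [/to1 h|/to2 h].
  apply: of2 => j i hj hij; rewrite -ltnS -nb_right_shift //; last by lia.
  by apply: h; lia.
apply: of1 => j i hj hij; rewrite nb_right_shift //; last by lia.
(* For j = 1 the bound holds because the right side is a successor; any larger j reduces to j - 1 in
   the shifted code. *)
by case: j hj hij => // -[//|j] hj hij; rewrite ltnS; apply: h; lia.
Qed.

Definition unshift_source (s : nat -> nat) (i : nat) : nat :=
  if i is j.+1 then (s j).+1 else 0.

Definition unshift_sink (m : nat) (t : nat -> nat) (i : nat) : nat :=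
  if i < m then (t i).+1 else (2 * m).+1.

(** Raising the old endpoints by one places them in 1, ..., 2m, which leaves 0 free for the new
    source and 2m + 1 for the new sink. *)
Lemma is_code_unshift m s t : is_code m s t ->
  is_code m.+1 (unshift_source s) (unshift_sink m t).
Proof.
move=> C.
have sb i : i < m -> s i < 2 * m.
  by move=> hi; have := code_lt C hi; have := code_bound C hi; lia.
split; rewrite /unshift_source /unshift_sink.
- case=> [|i] [|j] // ltij hj; rewrite ltnS.
  exact: (@code_incr _ _ _ C i j ltij hj).
- case=> [|i] hi; first by case: ifP; lia.
  have := code_incr C (ltnSn i); have := code_lt C (hi : i < m).
  by have := sb i hi; have := @code_lt _ _ _ C i.+1; case: ifP; lia.
- by move=> i hi; have := @code_bound _ _ _ C i; case: ifP; lia.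
- move=> i j hi hj; have := @code_bound _ _ _ C i.
  have := @code_bound _ _ _ C j; have := @code_inj _ _ _ C i j.
  by do 2 case: ifP; lia.
- case=> [|i] j hi hj; first by case: ifP; lia.
  have := @code_neq _ _ _ C i j; have := sb i.
  by case: ifP; lia.
Qed.

(** Source before sink in the old code turns back into [s i.+1 < t i] in the new one. *)
Lemma no_early_terminal_unshift m s t : is_code m s t ->
  no_early_terminal m (unshift_source s) (unshift_sink m t).
Proof.
move=> C; rewrite /unshift_sink; split=> [|i lti]; first by rewrite ltnn.
by rewrite lti /= ltnS (code_lt C).
Qed.

(** * Assembling the bijection *)

Theorem proposition8p8 (k n : nat) (hk : 1 <= k) (hn : 2 <= n) :
  [/\ (forall T : {set chord n},
         T \in terminal_diagrams k n -> psi T \in terminal_diagrams k.-1 n.-1),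
      (forall T1 T2 : {set chord n},
         T1 \in terminal_diagrams k n -> T2 \in terminal_diagrams k n ->
         psi T1 = psi T2 -> T1 = T2) &
      (forall D : {set chord n.-1},
         D \in terminal_diagrams k.-1 n.-1 ->
         exists2 T : {set chord n}, T \in terminal_diagrams k n & psi T = D)].
Proof.
case: n hn => [//|m _]; case: k hk => [//|k _].
have codeP (T : {set chord m.+1}) : T \in terminal_diagrams k.+1 m.+1 ->
    exists s t, [/\ is_code m.+1 s t, no_early_terminal m s t &
      T = decode m.+1 s t].
  rewrite inE => /andP[/chord_diagram_code[s [t [C ->]]] hT].
  by exists s, t; split=> //; apply: terminal_no_early_terminal hT.
split=> [T hT|T1 T2 hT1 hT2|D].
- have [s [t [C NT eT]]] := codeP T hT; move: hT.
  rewrite eT psi_decode // !inE => /andP[_ /(terminal_shift _ C NT) ->].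
  by rewrite andbT; apply/decode_chord_diagram/is_code_shift.
- have [s [t [C NT ->]]] := codeP T1 hT1.
  have [s' [t' [C' NT' ->]]] := codeP T2 hT2.
  rewrite !psi_decode // => eD; apply: eq_decode => i ltim1.
  have eq_shift := decode_inj (is_code_shift C NT) (is_code_shift C' NT') eD.
  (* The entries forgotten by the shift, [s 0] and [t m], are forced to be 0 and 2m + 1. The others
     are positive, so taking predecessors loses nothing. *)
  split.
    case: i ltim1 => [|i] hi.
      by rewrite (code_first_source C) ?(code_first_source C').
    have [e _] := eq_shift i hi.
    have := code_incr C (ltn0Sn i) hi; have := code_incr C' (ltn0Sn i) hi; lia.
  have [ltim|leim] := ltnP i m; last first.
    have -> : i = m by lia.
    by have [-> _] := NT; have [-> _] := NT'.
  have [_ e] := eq_shift i ltim.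
  have [_ /(_ i ltim)] := NT; have [_ /(_ i ltim)] := NT'; lia.
rewrite inE => /andP[/chord_diagram_code[s [t [C ->]]] hD].
have C' := is_code_unshift C; have NT' := no_early_terminal_unshift C.
have eD : decode m (fun i => (unshift_source s i.+1).-1)
            (fun i => (unshift_sink m t i).-1) = decode m s t.
  by apply: eq_decode => i lti; rewrite /unshift_sink lti.
exists (decode m.+1 (unshift_source s) (unshift_sink m t)).
  rewrite inE decode_chord_diagram //=.
  by apply/(terminal_shift _ C' NT'); rewrite eD.
by rewrite psi_decode.
Qed.
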